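(* Let $\omega = (w_1, \dots, w_n) \in \Delta_n$ and $A_1, \dots, A_n \in \mathbb{P}_m$, and let $\Omega(\omega; A_1, \dots, A_n)$ be the Wasserstein mean. Then $$\Omega(\omega; A_1, \dots, A_n) \geq 2 I - \sum_{j=1}^{n} w_j A_j^{-1}.$$
   Context: $\mathbb{P}_m$ is the set of all $m \times m$ complex positive definite Hermitian matrices. For Hermitian matrices, $A \leq B$ (equivalently $B \geq A$) means that $B - A$ is positive semi-definite. $I$ is the $m\times m$ identity matrix. $\Delta_n$ is the set of positive probability vectors $\omega = (w_1, \dots, w_n) \in \mathbb{R}^n$, i.e. $w_j > 0$ for all $j$ and $\sum_{j=1}^n w_j = 1$. The Wasserstein metric on $\mathbb{P}_m$ is $$d(A,B) = \left[ \operatorname{tr}\left( \frac{A+B}{2} \right) - \operatorname{tr} (A^{1/2} B A^{1/2})^{1/2} \right]^{1/2}.$$ The Wasserstein mean is the unique minimizer $$\Omega(\omega; A_1, \dots, A_n) = \underset{X \in \mathbb{P}_m}{\arg\min} \sum_{j=1}^n w_j d^2(X, A_j);$$ it is known to exist, to be unique, and to coincide with the unique solution $X \in \mathbb{P}_m$ of $X = \sum_{j=1}^n w_j (X^{1/2} A_j X^{1/2})^{1/2}$, equivalently of $I = \sum_{j=1}^n w_j (A_j \# X^{-1})$, where $A \# B = A^{1/2}(A^{-1/2} B A^{-1/2})^{1/2} A^{1/2}$. *)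

(* Defs.v *)
From HB Require Import structures.
From mathcomp Require Import all_boot all_order all_algebra.
From mathcomp Require Import complex reals.

Set Implicit Arguments.
Unset Strict Implicit.
Unset Printing Implicit Defensive.

Import Order.TTheory GRing.Theory Num.Theory.

Local Open Scope ring_scope.
Local Open Scope sesquilinear_scope.
Local Open Scope complex_scope.

Section PositiveMatrices.
Context {C : numClosedFieldType} {m : nat}.
Implicit Types A B : 'M[C]_m.

(* In a numClosedFieldType, [0 <= z] and [0 < z] entail that z is real. *)
Definition psdmx A : Prop :=
  A \is hermsymmx /\ forall v : 'cV[C]_m, 0 <= (v ^t* *m A *m v) 0 0.

Definition pdmx A : Prop :=
  A \is hermsymmx /\ forall v : 'cV[C]_m, v != 0 -> 0 < (v ^t* *m A *m v) 0 0.

Definition loewner_le A B : Prop := psdmx (B - A).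

(* Functional calculus: for A = P^-1 D P with P unitary and D diagonal, the    *)
(* root is P^-1 D^(1/2) P. It is meaningful for A positive semi-definite only; *)
(* lemmas sqrtmx_psd, sqrtmxK and sqrtmx_uniq below characterize it there.     *)
Definition sqrtmx A : 'M[C]_m :=
  invmx (spectralmx A) *m diag_mx (map_mx sqrtC (spectral_diag A))
    *m spectralmx A.

End PositiveMatrices.

Section WassersteinMean.
Context {R : realType} {m : nat}.
Implicit Types A B X : 'M[R[i]]_m.

(* For A and B positive definite the trace expression is a nonnegative real, *)
(* so that taking the real part only changes its type.                       *)
Definition wasserstein_dist A B : R :=
  Num.sqrt (complex.Re
    (\tr (2^-1 *: (A + B)) - \tr (sqrtmx (sqrtmx A *m B *m sqrtmx A)))).

Definition positive_prob_vector n (w : 'I_n -> R) : Prop :=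
  (forall j, 0 < w j) /\ \sum_(j < n) w j = 1.

Definition wasserstein_cost n (w : 'I_n -> R) (A : 'I_n -> 'M[R[i]]_m) X : R :=
  \sum_(j < n) w j * wasserstein_dist X (A j) ^+ 2.

Definition is_wasserstein_mean n (w : 'I_n -> R) (A : 'I_n -> 'M[R[i]]_m) X
    : Prop :=
  pdmx X /\
  forall Y, pdmx Y -> wasserstein_cost w A X <= wasserstein_cost w A Y.

End WassersteinMean.

Section SqrtmxTheory.
Context {C : numClosedFieldType} {m : nat}.
Implicit Types A B : 'M[C]_m.

Lemma spectral_diag_ge0 A i : psdmx A -> 0 <= spectral_diag A 0 i.
Proof.
move=> [Ah Ap].
have U := spectral_unitarymx A.
have /orthomx_spectralP := hermitian_normalmx Ah.
rewrite invmx_unitary //; set P := spectralmx A in U *.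
set D := spectral_diag A => AE; have := Ap (P ^t* *m delta_mx i 0).
rewrite trmx_mul map_mxM trmxCK AE !mulmxA mulmxtVK // -!mulmxA.
rewrite [P *m (_ *m _)]mulmxA.
rewrite (unitarymxP U) mul1mx mul_diag_mx mxE (bigD1 i) //= big1.
  by rewrite !mxE !eqxx /= conjC1 addr0 mul1r mulr1.
by move=> j /negPf ji; rewrite !mxE ji /= mulr0 mulr0.
Qed.

Lemma psdmx_conj A B : psdmx A -> psdmx (B ^t* *m A *m B).
Proof.
move=> [Ah Ap]; split.
  apply/is_hermitianmxP; rewrite expr0 scale1r !trmx_mul !map_mxM trmxCK.
  have := is_hermitianmxP _ _ _ Ah; rewrite expr0 scale1r => <-.
  by rewrite mulmxA.
by move=> v; have := Ap (B *m v); rewrite trmx_mul map_mxM !mulmxA.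
Qed.

Lemma diag_psdmx (d : 'rV[C]_m) : (forall i, 0 <= d 0 i) -> psdmx (diag_mx d).
Proof.
move=> d0; split.
  apply/is_hermitianmxP; rewrite expr0 scale1r tr_diag_mx map_diag_mx.
  congr diag_mx; apply/rowP => i; rewrite !mxE.
  by apply/esym/CrealP; exact: ger0_real.
move=> v; rewrite -mulmxA mul_diag_mx mxE sumr_ge0 // => i _.
by rewrite !mxE mulrCA mulr_ge0 // mulrC mul_conjC_ge0.
Qed.

Lemma sqrtmx_psd A : psdmx A -> psdmx (sqrtmx A).
Proof.
move=> Ap; rewrite /sqrtmx invmx_unitary ?spectral_unitarymx //.
apply/psdmx_conj/diag_psdmx => i.
by rewrite mxE sqrtC_ge0 spectral_diag_ge0.
Qed.

Lemma sqrtmxK A : psdmx A -> sqrtmx A *m sqrtmx A = A.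
Proof.
move=> Ap; have U := spectral_unit A.
have /orthomx_spectralP {3}-> := hermitian_normalmx (proj1 Ap).
rewrite /sqrtmx !mulmxA mulmxK // -[X in X *m _ = _]mulmxA mulmx_diag.
congr (_ *m diag_mx _ *m _); apply/rowP => i.
by rewrite !mxE -expr2 sqrtCK.
Qed.

Lemma sqrtmx_uniq A B : psdmx A -> psdmx B -> B *m B = A -> B = sqrtmx A.
Proof.
move=> Ap Bp BB; rewrite /sqrtmx.
have /orthomx_spectralP AE := hermitian_normalmx (proj1 Ap).
have /orthomx_spectralP BE := hermitian_normalmx (proj1 Bp).
have Pu := spectral_unit A; have Qu := spectral_unit B.
move: (fun i => spectral_diag_ge0 i Ap) (fun i => spectral_diag_ge0 i Bp).
set P := spectralmx A in AE Pu *; set D := spectral_diag A in AE *.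
set Q := spectralmx B in BE Qu *; set E := spectral_diag B in BE *.
move=> D0 E0; set S := map_mx sqrtC D.
pose W := Q *m invmx P.
have EEW : diag_mx E *m diag_mx E *m W = W *m diag_mx D.
  have QB : diag_mx E *m Q = Q *m B by rewrite BE !mulmxA mulmxV // mul1mx.
  rewrite /W !mulmxA -[_ *m _ *m Q]mulmxA QB mulmxA QB -[_ *m B *m B]mulmxA BB.
  by rewrite AE !mulmxA mulmxK.
have EW : diag_mx E *m W = W *m diag_mx S.
  move: W EEW => W EEW; apply/matrixP => i j; move/matrixP/(_ i j): EEW.
  rewrite -mulmxA !mul_diag_mx !mul_mx_diag !mxE.
  have [-> //|W0] := eqVneq (W i j) 0; first by rewrite !(mul0r, mulr0).
  rewrite mulrA -expr2 [RHS]mulrC => /(mulIf W0) <-.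
  by rewrite sqrCK // mulrC.
have -> : B = invmx Q *m (diag_mx E *m W) *m P.
  by rewrite /W !mulmxA mulmxKV.
by rewrite EW /W !mulmxA mulVmx // mul1mx.
Qed.

End SqrtmxTheory.

(* Main.v *)
(* At the minimizer X put G_j := A_j # X^-1, the positive definite solution of
   G_j X G_j = A_j, and S := \sum_j w_j G_j. Then
   d(X, A_j)^2 = tr ((I - G_j) X (I - G_j)) / 2, while Cauchy-Schwarz gives
   d(S X S, A_j)^2 <= tr ((S - G_j) X (S - G_j)) / 2. Comparing the costs of X
   and S X S, the variance decomposition leaves tr ((I - S) X (I - S)) <= 0,
   hence S = I; no derivative of the square root is needed. The bound is the
   w-average of X + A_j^-1 >= 2 G_j^-1 >= 4 I - 2 G_j. *)
Require Import Defs.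
From HB Require Import structures.
From mathcomp Require Import all_boot all_order all_algebra.
From mathcomp Require Import complex reals ring.

Import Order.TTheory GRing.Theory Num.Theory.

Local Open Scope ring_scope.
Local Open Scope complex_scope.

(** * Positive definite matrices, trace inequalities and the Riccati equation *)

Section PositiveDefinite.
Set Implicit Arguments.
Unset Strict Implicit.
Local Open Scope sesquilinear_scope.
Context {C : numClosedFieldType} {m : nat}.
Implicit Types A B G H K X : 'M[C]_m.

Lemma hermsymmxE A : A \is hermsymmx <-> A ^t* = A.
Proof.
split=> [/is_hermitianmxP|AE]; first by rewrite expr0 scale1r => {2}->.
by apply/is_hermitianmxP; rewrite expr0 scale1r AE.
Qed.

Lemma adjmxB A B : (A - B) ^t* = A ^t* - B ^t*.
Proof. by rewrite linearB map_mxB. Qed.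

Lemma mxtraceB A B : \tr (A - B) = \tr A - \tr B.
Proof. exact: raddfB. Qed.

Lemma psdmx_adj A : psdmx A -> A ^t* = A.
Proof. by case=> /hermsymmxE. Qed.

Lemma pdmx_psd A : pdmx A -> psdmx A.
Proof.
case=> Ah Ap; split=> // v; have [->|v0] := eqVneq v 0; last exact/ltW/Ap.
by rewrite mulmx0 mxE.
Qed.

Lemma pdmx_adj A : pdmx A -> A ^t* = A.
Proof. by move/pdmx_psd/psdmx_adj. Qed.

Lemma psdmx0 : psdmx (0 : 'M[C]_m).
Proof.
split; first by apply/hermsymmxE; rewrite trmx0 map_mx0.
by move=> v; rewrite mulmx0 mul0mx mxE.
Qed.

Lemma psdmxD A B : psdmx A -> psdmx B -> psdmx (A + B).
Proof.
move=> Ap Bp; split.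
  by apply/hermsymmxE; rewrite linearD map_mxD /= !psdmx_adj.
by move=> v; rewrite mulmxDr mulmxDl mxE addr_ge0 ?(proj2 Ap) ?(proj2 Bp).
Qed.

Lemma psdmxZ (a : C) A : 0 <= a -> psdmx A -> psdmx (a *: A).
Proof.
move=> a0 Ap; split.
  by apply/hermsymmxE; rewrite linearZ map_mxZ /= psdmx_adj // geC0_conj.
by move=> v; rewrite -scalemxAr -scalemxAl mxE mulr_ge0 ?(proj2 Ap).
Qed.

Lemma psdmx_sum n (a : 'I_n -> C) (F : 'I_n -> 'M[C]_m) :
  (forall j, 0 <= a j) -> (forall j, psdmx (F j)) ->
  psdmx (\sum_(j < n) a j *: F j).
Proof.
move=> a0 Fp; elim/big_ind: _ => [||j _]; [exact: psdmx0|exact: psdmxD|].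
exact: psdmxZ.
Qed.

Lemma pdmx_unit A : pdmx A -> A \in unitmx.
Proof.
move=> [Ah Ap]; rewrite -unitmx_tr -row_free_unit -kermx_eq0.
apply/eqP/row_matrixP => i; rewrite row0; apply/eqP; apply: contraT.
set u := row i _ => u0.
have Au : A *m u^T = 0.
  by rewrite -[A]trmxK -trmx_mul /u -row_mul mulmx_ker row0 trmx0.
have := Ap u^T; rewrite -mulmxA Au mulmx0 mxE ltxx trmx_eq0.
by move=> /(_ u0).
Qed.

(** The form at v is the squared norm of A^(1/2) v. If it vanishes, then A v = A^(1/2) (A^(1/2) v) =
    0, so v = 0 by invertibility. *)
Lemma psdmx_unit_pd A : psdmx A -> A \in unitmx -> pdmx A.
Proof.
move=> Ap Au; split; first exact: (proj1 Ap).
move=> v v0; have Sh := psdmx_adj (sqrtmx_psd Ap).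
have -> : v ^t* *m A *m v = (sqrtmx A *m v) ^t* *m (sqrtmx A *m v).
  by rewrite trmx_mul map_mxM Sh mulmxA -[_ *m sqrtmx A *m sqrtmx A]mulmxA sqrtmxK.
set u := sqrtmx A *m v; have u0 : u != 0.
  apply: contra_neq v0 => uE.
  by rewrite -[v](mulKmx Au) -[A in A *m v]sqrtmxK // -mulmxA -/u uE !mulmx0.
rewrite lt_def; have uu i : 0 <= u ^t* 0 i * u i 0.
  by rewrite !mxE mulrC mul_conjC_ge0.
rewrite [X in _ <= X]mxE sumr_ge0 ?andbT //.
apply: contra_neq u0; rewrite mxE => /psumr_eq0P uE.
apply/colP => i; have /eqP := uE (fun i _ => uu i) i isT.
by rewrite !mxE mulrC mul_conjC_eq0 => /eqP.
Qed.

Lemma pdmx_sqrt A : pdmx A -> pdmx (sqrtmx A).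
Proof.
move=> Ap; have Ap' := pdmx_psd Ap.
apply: psdmx_unit_pd; first exact: sqrtmx_psd.
by have := pdmx_unit Ap; rewrite -{1}(sqrtmxK Ap') unitmx_mul => /andP[].
Qed.

Lemma pdmx_conj A B : pdmx A -> pdmx B -> pdmx (B *m A *m B).
Proof.
move=> Ap Bp; apply: psdmx_unit_pd; last by rewrite !unitmx_mul !pdmx_unit.
by rewrite -{1}(pdmx_adj Bp); apply/psdmx_conj/pdmx_psd.
Qed.

Lemma pdmx_inv A : pdmx A -> pdmx (invmx A).
Proof.
move=> Ap; have Au := pdmx_unit Ap.
apply: psdmx_unit_pd; last by rewrite unitmx_inv.
have Ah : (invmx A) ^t* = invmx A.
  by rewrite trmx_inv map_invmx pdmx_adj.
rewrite -[invmx A]mul1mx -{1}[1%:M](mulVmx Au) -{1}Ah.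
exact/psdmx_conj/pdmx_psd.
Qed.

Lemma pdmx_sum n (a : 'I_n -> C) (F : 'I_n -> 'M[C]_m) :
  (0 < n)%N -> (forall j, 0 < a j) -> (forall j, pdmx (F j)) ->
  pdmx (\sum_(j < n) a j *: F j).
Proof.
move=> n0 a0 Fp; split.
  apply: (proj1 (psdmx_sum _ _)) => j; first exact/ltW.
  exact/pdmx_psd.
move=> v v0; rewrite mulmx_sumr mulmx_suml summxE.
have F0 j : 0 < (v ^t* *m (a j *: F j) *m v) 0 0.
  by rewrite -scalemxAr -scalemxAl mxE mulr_gt0 // (proj2 (Fp j)).
rewrite (bigD1 (Ordinal n0)) //= ltr_pwDl // sumr_ge0 // => j _.
exact/ltW.
Qed.

Lemma conj_col_diag X B i :
  ((col i B) ^t* *m X *m col i B) 0 0 = (B ^t* *m X *m B) i i.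
Proof.
rewrite tr_col map_row -row_mul [LHS]mxE [RHS]mxE.
by apply: eq_bigr => k _; rewrite [row _ _ _ _]mxE [col _ _ _ _]mxE.
Qed.

Lemma psdmx_diag_ge0 A i : psdmx A -> 0 <= A i i.
Proof.
move=> [_ Ap]; have := Ap (col i 1%:M).
by rewrite conj_col_diag trmx1 map_mx1 mul1mx mulmx1.
Qed.

Lemma psdmx_trace_ge0 A : psdmx A -> 0 <= \tr A.
Proof. by move=> Ap; apply: sumr_ge0 => i _; exact: psdmx_diag_ge0. Qed.

(** A B need not be Hermitian, but by cyclicity its trace is that of the congruence B^(1/2) A
    B^(1/2). *)
Lemma psdmx_trace_mul_ge0 A B : psdmx A -> psdmx B -> 0 <= \tr (A *m B).
Proof.
move=> Ap Bp; have Sp := sqrtmx_psd Bp.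
rewrite -(sqrtmxK Bp) mulmxA mxtrace_mulC mulmxA.
by apply: psdmx_trace_ge0; rewrite -{1}(psdmx_adj Sp); exact: psdmx_conj.
Qed.

(** The trace sums the quadratic form of X over the columns of B. These nonnegative terms must all
    vanish, and definiteness then kills every column. *)
Lemma trace_conj_le0 X B : pdmx X -> \tr (B ^t* *m X *m B) <= 0 -> B = 0.
Proof.
move=> Xp tr0; have BXp := psdmx_conj B (pdmx_psd Xp).
have /psumr_eq0P trE : \tr (B ^t* *m X *m B) = 0.
  by apply/le_anti; rewrite tr0 psdmx_trace_ge0.
apply/trmx_inj/row_matrixP => i; rewrite -tr_col trmx0 row0.
apply/eqP; rewrite trmx_eq0; apply: contraT => /(proj2 Xp).
by rewrite conj_col_diag trE ?ltxx // => k _; exact: psdmx_diag_ge0.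
Qed.

Lemma pdmx_riccati X A : pdmx X -> pdmx A -> exists2 G, pdmx G & G *m X *m G = A.
Proof.
move=> Xp Ap.
have [Q Qp QQ] : exists2 Q, pdmx Q & Q *m Q = X.
  by exists (sqrtmx X); [exact: pdmx_sqrt|exact/sqrtmxK/pdmx_psd].
have QAQp := pdmx_conj Ap Qp; have Qu := pdmx_unit Qp.
have [T Tp TT] : exists2 T, pdmx T & T *m T = Q *m A *m Q.
  by exists (sqrtmx (Q *m A *m Q)); [exact: pdmx_sqrt|exact/sqrtmxK/pdmx_psd].
(* With Q = X^(1/2) this is X^(-1/2) (X^(1/2) A X^(1/2))^(1/2) X^(-1/2), that is A # X^-1. *)
exists (invmx Q *m T *m invmx Q); first exact/pdmx_conj/pdmx_inv.
rewrite -QQ !mulmxA mulmxKV // mulmxK // -[_ *m T *m T]mulmxA TT.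
by rewrite !mulmxA mulVmx // mul1mx mulmxK.
Qed.

(** With Q = X^(1/2), the matrix Q G Q is positive and squares to Q (G X G) Q, so it is the outer
    root; cyclicity then moves Q around the trace. *)
Lemma trace_sqrtmx_riccati X G : pdmx X -> pdmx G ->
  \tr (sqrtmx (sqrtmx X *m (G *m X *m G) *m sqrtmx X)) = \tr (G *m X).
Proof.
move=> Xp Gp; have Qp := pdmx_sqrt Xp.
have := sqrtmxK (pdmx_psd Xp); move: (sqrtmx X) Qp => Q Qp QQ.
rewrite -(@sqrtmx_uniq _ _ _ (Q *m G *m Q)).
- by rewrite -mulmxA mxtrace_mulC -mulmxA QQ.
- exact/pdmx_psd/pdmx_conj/Qp/pdmx_conj.
- exact/pdmx_psd/pdmx_conj.
- by rewrite -QQ !mulmxA.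
Qed.

Lemma trace_conj_subE X K G : K ^t* = K -> G ^t* = G ->
  \tr ((K - G) ^t* *m X *m (K - G)) =
  \tr (K *m X *m K) + \tr (G *m X *m G)
  - (\tr (K *m X *m G) + \tr (G *m X *m K)).
Proof.
move=> Kh Gh; rewrite adjmxB Kh Gh !(mulmxBl, mulmxBr) !mxtraceB.
by ring.
Qed.

(* Cauchy-Schwarz for the weight H^-1: expand
   tr ((H K - G) X (K H - G) H^-1) >= 0, where H (K X K) H = G X G. *)
Lemma trace_cross_le X K G H : pdmx X -> K ^t* = K -> G ^t* = G -> pdmx H ->
  H *m (K *m X *m K) *m H = G *m X *m G ->
  \tr (K *m X *m G) + \tr (G *m X *m K) <= \tr (H *m (K *m X *m K)) *+ 2.
Proof.
move=> Xp Kh Gh Hp E; have Hu := pdmx_unit Hp; have Hh := pdmx_adj Hp.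
have NX := psdmx_conj (K *m H - G) (pdmx_psd Xp).
have := psdmx_trace_mul_ge0 NX (pdmx_psd (pdmx_inv Hp)).
rewrite adjmxB trmx_mul map_mxM /= Kh Gh Hh.
rewrite !(mulmxBl, mulmxBr) !mxtraceB -E !mulmxA !(mulmxK Hu).
have -> : \tr (H *m K *m X *m G *m invmx H) = \tr (K *m X *m G).
  by rewrite mxtrace_mulC !mulmxA mulVmx // mul1mx.
move=> N0; rewrite -subr_ge0; apply: le_trans N0 _.
by rewrite le_eqVlt; apply/orP; left; apply/eqP; ring.
Qed.

End PositiveDefinite.

(** * Distance estimates and the optimality equation of the mean *)

Section Wasserstein.
Local Open Scope sesquilinear_scope.
Context {R : realType} {m : nat}.
Set Implicit Arguments.
Unset Strict Implicit.
Implicit Types A X K G : 'M[R[i]]_m.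

Lemma Re_le (x y : R[i]) : x <= y -> complex.Re x <= complex.Re y.
Proof. by rewrite lecE => /andP[]. Qed.

Lemma Re_realM (a : R) (x : R[i]) :
  complex.Re (a%:C * x) = a * complex.Re x.
Proof. by case: x => x y /=; rewrite mul0r subr0. Qed.

(** In transport terms, (K x, G x) with x of covariance X is a coupling of covariances K X K and G X
    G, and the right-hand side is half its cost. Here H is the Riccati solution taking K X K to G X
    G, as [trace_cross_le] requires. *)
Lemma wasserstein_dist_conj_le X K G : pdmx X -> pdmx K -> pdmx G ->
  wasserstein_dist (K *m X *m K) (G *m X *m G) ^+ 2 <=
  complex.Re (2^-1 * \tr ((K - G) ^t* *m X *m (K - G))).
Proof.
move=> Xp Kp Gp; have Kh := pdmx_adj Kp; have Gh := pdmx_adj Gp.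
have Yp := pdmx_conj Xp Kp; have Ap := pdmx_conj Xp Gp.
have [H Hp HE] := pdmx_riccati Yp Ap.
rewrite /wasserstein_dist -HE trace_sqrtmx_riccati // HE mxtraceZ mxtraceD.
set x := (X in Num.sqrt (complex.Re X)); set y := (X in _ <= complex.Re X).
have xy : x <= y.
  rewrite /x /y trace_conj_subE // mulrBr lerD2l lerN2.
  rewrite ler_pdivrMl ?ltr0n // mulr_natl.
  exact: trace_cross_le.
(* [Num.sqrt] is 0 on negative numbers, so a negative radicand leaves only the nonnegativity of the
   right-hand side to check. *)
have [x0|x0] := leP 0 (complex.Re x); first by rewrite sqr_sqrtr // Re_le.
rewrite ltr0_sqrtr // expr0n; apply: (@Re_le 0).
rewrite mulr_ge0 ?invr_ge0 ?ler0n // psdmx_trace_ge0 //.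
exact/psdmx_conj/pdmx_psd.
Qed.

(** For K = I both cross terms equal tr (G X), so the radicand is exactly half the quadratic
    trace. *)
Lemma wasserstein_dist_riccati_ge X G : pdmx X -> pdmx G ->
  complex.Re (2^-1 * \tr ((1%:M - G) ^t* *m X *m (1%:M - G))) <=
  wasserstein_dist X (G *m X *m G) ^+ 2.
Proof.
move=> Xp Gp; have Gh := pdmx_adj Gp.
rewrite /wasserstein_dist trace_sqrtmx_riccati // mxtraceZ mxtraceD.
rewrite trace_conj_subE ?trmx1 ?map_mx1 // !(mul1mx, mulmx1).
rewrite (mxtrace_mulC X G); set x := (X in _ <= Num.sqrt (complex.Re X) ^+ 2).
set y := (X in complex.Re X <= _); have -> : y = x by rewrite /x /y; field.
have [x0|x0] := leP 0 (complex.Re x); first by rewrite sqr_sqrtr.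
exact/ltW/(lt_le_trans x0)/sqr_ge0.
Qed.

Lemma weighted_trace_variance n (w : 'I_n -> R) X (G : 'I_n -> 'M[R[i]]_m) :
  \sum_(j < n) w j = 1 -> (forall j, (G j) ^t* = G j) ->
  let S := \sum_(j < n) (w j)%:C *: G j in
  S ^t* = S ->
  \sum_(j < n) (w j)%:C * \tr ((1%:M - G j) ^t* *m X *m (1%:M - G j)) =
  \sum_(j < n) (w j)%:C * \tr ((S - G j) ^t* *m X *m (S - G j))
  + \tr ((1%:M - S) ^t* *m X *m (1%:M - S)).
Proof.
move=> w1 Gh S Sh.
have w1C : \sum_(j < n) (w j)%:C = 1 :> R[i] by rewrite -rmorph_sum w1.
(* For Hermitian K the weighted sum involves the G_j only through S and a term free of K. The claim
   compares its values at K = I and K = S. *)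
have E K : K ^t* = K ->
    \sum_(j < n) (w j)%:C * \tr ((K - G j) ^t* *m X *m (K - G j)) =
    \tr (K *m X *m K) + \sum_(j < n) (w j)%:C * \tr (G j *m X *m G j)
    - (\tr (K *m X *m S) + \tr (S *m X *m K)).
  move=> Kh; rewrite -[\tr (K *m X *m K)]mul1r -w1C mulr_suml.
  rewrite mulmx_sumr !mulmx_suml !raddf_sum -!big_split /= -sumrB.
  apply: eq_bigr => j _; rewrite trace_conj_subE //.
  rewrite -scalemxAr -!scalemxAl !mxtraceZ; ring.
rewrite !E // ?trmx1 ?map_mx1 // trace_conj_subE ?trmx1 ?map_mx1 //; ring.
Qed.

Lemma wasserstein_mean_riccati n (w : 'I_n -> R) (A : 'I_n -> 'M[R[i]]_m) X
    (G : 'I_n -> 'M[R[i]]_m) :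
  positive_prob_vector w -> is_wasserstein_mean w A X ->
  (forall j, pdmx (G j)) -> (forall j, G j *m X *m G j = A j) ->
  \sum_(j < n) (w j)%:C *: G j = 1%:M.
Proof.
move=> [w0 w1] [Xp Xmin] Gp GE; set S := \sum_(j < n) _.
have n0 : (0 < n)%N.
  case: n w {w0 A G Xmin Gp GE S} w1 => // w /eqP.
  by rewrite big_ord0 eq_sym oner_eq0.
(* Definiteness of S makes S X S an admissible competitor. *)
have Sp : pdmx S by apply: pdmx_sum => // j; rewrite ltcR.
have := Xmin _ (pdmx_conj Xp Sp).
pose f K := \sum_(j < n) (w j)%:C * \tr ((K - G j) ^t* *m X *m (K - G j)).
have fE K : complex.Re (2^-1 * f K) =
    \sum_(j < n) w j * complex.Re (2^-1 * \tr ((K - G j) ^t* *m X *m (K - G j))).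
  rewrite mulr_sumr raddf_sum; apply: eq_bigr => j _ /=.
  by rewrite mulrCA Re_realM.
move=> le_cost; have : complex.Re (2^-1 * f 1%:M) <= complex.Re (2^-1 * f S).
  (* The chain is f(I)/2 <= cost of X <= cost of S X S <= f(S)/2, in real parts. *)
  rewrite !fE; apply: le_trans (le_trans le_cost _); apply: ler_sum => j _.
    by rewrite ler_pM2l // -GE wasserstein_dist_riccati_ge.
  by rewrite ler_pM2l // -GE wasserstein_dist_conj_le.
have -> : f 1%:M = f S + \tr ((1%:M - S) ^t* *m X *m (1%:M - S)).
  by apply: weighted_trace_variance; rewrite ?pdmx_adj // => j; rewrite pdmx_adj.
set t := \tr _; have t0 : 0 <= t.
  exact/psdmx_trace_ge0/psdmx_conj/pdmx_psd.
rewrite mulrDr raddfD /= gerDl => Ret.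
suff /(trace_conj_le0 Xp)/eqP : t <= 0 by rewrite subr_eq0 => /eqP.
have {Ret} : complex.Re t <= 0.
  have V2 : 2^-1 = (2^-1)%:C :> R[i] by rewrite fmorphV rmorph_nat.
  by rewrite V2 Re_realM pmulr_rle0 ?invr_gt0 ?ltr0n in Ret.
(* Since [0 <= t] makes t real, the bound on its real part suffices. *)
by move: t0; rewrite !lecE /= => /andP[/eqP -> _] ->; rewrite eqxx.
Qed.

End Wasserstein.

(** * From the Riccati solutions to the Loewner bound *)

Lemma riccati_inv_bound (C : numClosedFieldType) (m : nat) (X G : 'M[C]_m) :
  pdmx X -> pdmx G ->
  psdmx (X + invmx (G *m X *m G) - 4%:R *: 1%:M + 2%:R *: G).
Proof.
move=> Xp Gp; have Xu := pdmx_unit Xp; have Gu := pdmx_unit Gp.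
have Hp := pdmx_inv Gp; have Hh := pdmx_adj Hp; have Gh := pdmx_adj Gp.
have Xh := pdmx_adj Xp.
have AE : invmx (G *m X *m G) = invmx G *m invmx X *m invmx G.
  have Yu := pdmx_unit (pdmx_conj Xp Gp).
  by rewrite -[RHS](mulmxK Yu) !mulmxA !mulmxKV // mulVmx // mul1mx.
(* [E1] expands to X - 2 G^-1 + (G X G)^-1 and [E2] to G^-1 - 2 I + G; adding twice the second to
   the first cancels G^-1. *)
have E1 := psdmx_conj (X - invmx G) (pdmx_psd (pdmx_inv Xp)).
have E2 := psdmx_conj (1%:M - G) (pdmx_psd Hp).
have := psdmxD E1 (psdmxZ (ler0n C 2) E2).
rewrite !adjmxB Xh Hh Gh trmx1 map_mx1 !(mulmxBl, mulmxBr) AE.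
rewrite !(mulmx1, mul1mx) !mulmxV // mul1mx mulmxKV // mulVmx // mul1mx.
rewrite mul1mx; set B := _ *m invmx G; move: (invmx G) B => H B; congr psdmx.
by apply/matrixP => i j; rewrite !mxE; ring.
Qed.

Theorem theorem4p4 (R : realType) (m n : nat) (w : 'I_n -> R)
    (A : 'I_n -> 'M[R[i]]_m) (Omega : 'M[R[i]]_m)
    (hw : positive_prob_vector w)
    (hA : forall j, pdmx (A j))
    (hOmega : is_wasserstein_mean w A Omega) :
  loewner_le (2%:R *: 1%:M - \sum_(j < n) (w j)%:C *: invmx (A j)) Omega.
Proof.
have [[w0 w1] [Xp _]] := (hw, hOmega).
have GP j : exists G, pdmx G /\ G *m Omega *m G = A j.
  by have [G] := pdmx_riccati Xp (hA j); exists G.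
have [G {}GP] := boolp.choice GP.
have GS : \sum_(j < n) (w j)%:C *: G j = 1%:M.
  by apply: wasserstein_mean_riccati hOmega _ _ => // j; case: (GP j).
have w1C : \sum_(j < n) (w j)%:C = 1 :> R[i] by rewrite -rmorph_sum w1.
rewrite /loewner_le.
(* The 4 I becomes 2 I because the weighted sum of the 2 G_j is 2 I. *)
have -> : Omega - (2%:R *: 1%:M - \sum_(j < n) (w j)%:C *: invmx (A j)) =
    \sum_(j < n) (w j)%:C *: (Omega + invmx (A j) - 4%:R *: 1%:M + 2%:R *: G j).
  under [RHS]eq_bigr do rewrite !scalerDr (scalerA _ 2%:R) (mulrC _ 2%:R) -scalerA.
  rewrite !big_split /= -!scaler_suml -scaler_sumr GS w1C !scale1r.
  by move: (\sum_(j < n) _) => B; apply/matrixP => i j; rewrite !mxE; ring.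
apply: psdmx_sum => j; first by rewrite lecR ltW.
by have [Gp <-] := GP j; exact: riccati_inv_bound.
Qed.
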